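(* Let $K,L,M$ be positive integers and let $W$ be a random variable with values in $\{0,1,2,\dots\}$ and $\mathbb{E}[W]<\infty$. Consider a slotted ALOHA radar network with slot length $\Delta>0$, chirp length $K$ slots, $L$ chirps per packet and generic backoff $W$, in which each interfering radar has clock offset $\delta$ with $0<\delta<\Delta$ and distance $d\ge 0$ with respect to a tagged radar; put $\delta_1=\delta+d/c$, where $c$ is the propagation speed. Suppose the tagged radar starts a packet in slot $t_1$. For a given interfering radar and $i\in\{-(L-1),\dots,L-1\}$, let $E_i$ be the event that this radar starts a packet transmission in slot $t_1+iK-1-\lfloor \delta_1/\Delta\rfloor$ or in slot $t_1+iK+1-\lceil \delta_1/\Delta\rceil$. (1) In a two-radar network, the probability of interference at the tagged radar, $p_{I2}=\mathbb{P}\big(\bigcup_{i=-(L-1)}^{L-1}E_i\big)$, is $$p_{I2}=(2L-1)\,q-\frac{1}{KL+\mathbb{E}[W]}\sum_{i=0}^{L-2}(L-i-1)\Big(2\,\mathbb{P}(W=iK)+\mathbb{P}(W=iK+1)+\mathbb{P}(W=iK-1)\Big),$$ where $q$ is the common value of $\mathbb{P}(E_i)$, given by $$q=\begin{cases}\dfrac{2}{KL+\mathbb{E}[W]} & \text{if } KL>1,\\[2mm] \dfrac{1}{1+\mathbb{E}[W]}+\dfrac{1-\mathbb{P}(W=0)}{L+\mathbb{E}[W]} & \text{if } KL=1.\end{cases}$$ (2) In an $M$-radar network, the probability of interference $p_I$ at the tagged radar, i.e. the probability that for at least one of the $M-1$ other radars one of the corresponding events $E_i$ occurs, is $$p_I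=1-(1-p_{I2})^{M-1}.$$
   Context: Slotted ALOHA: time is divided into slots of length $\Delta$, indexed by integers on each radar's own clock. Each radar repeats transmission cycles: it transmits a packet of $L$ contiguous chirps, each lasting $K$ slots (so a packet occupies $KL$ consecutive slots), then stays silent (backoff) for a random number of slots, then starts its next packet in the slot immediately after the backoff, and so on. Successive backoffs of a radar are i.i.d. copies of $W$, and the radars evolve independently of each other. Probabilities: the probability that a radar is in a given state in a slot is its long-run fraction of slots spent in that state; in particular the probability that an interfering radar starts a packet in any given slot is $\frac{1}{KL+\mathbb{E}[W]}$. Clock offset: $\delta$ is the time between a clock tick of the tagged radar and the clock tick of the interfering radar that comes immediately after it. Interference: a chirp of the tagged radar starting in its slot $s$ is interfered with by a chirp that the other radar starts in its own slot $s'$ if $(s-1)\Delta< s'\Delta+\delta_1<(s+1)\Delta$. The tagged radar suffers interference if at least one of the $L$ chirps of its packet is interfered with; the events $E_{-(L-1)},\dots,E_{L-1}$ are the ones taken to cause this.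
   Formalization: The closed form for p_I2 is stated only for K>1 or L=1 (it is false e.g. for K=1, L=2, W=2), and δ_1/Δ is assumed not to be an integer for every interfering radar (otherwise P(E_i)=q fails, e.g. K=2, L=1, W=0). *)

(* Defs.v *)
From HB Require Import structures.
From mathcomp Require Import all_boot all_order all_algebra.
From mathcomp Require Import all_classical all_reals all_analysis.
Set Implicit Arguments.
Unset Strict Implicit.
Unset Printing Implicit Defensive.
Import Order.TTheory GRing.Theory Num.Theory.
Import numFieldNormedType.Exports.
Local Open Scope classical_set_scope.
Local Open Scope ring_scope.

Definition Pr d (T : measurableType d) (R : realType) (P : probability T R)
  (A : set T) : R := fine (P A).

(* The history of a radar is a process X : int -> T -> nat, where X t w is the
   number of slots elapsed in slot t since the start of the current
   transmission cycle.  With N = K * L the packet length in slots, X t w = 0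
   means that a packet starts in slot t, X t w < N that the radar transmits in
   slot t, and N <= X t w that it is in backoff. *)

Definition starts_packet T (X : int -> T -> nat) (s : int) : set T :=
  [set w | X s w = 0%N].

(* A packet starts in slot s, and the successive backoffs from then on are
   ws`_0, ws`_1, and so on. *)
Fixpoint backoffs_from T (N : nat) (X : int -> T -> nat) (s : int)
    (ws : seq nat) (w : T) : Prop :=
  match ws with
  | [::] => X s w = 0%N
  | b :: ws' => (forall k : nat, (k < N + b)%N -> X (s + k%:Z) w = k) /\
                backoffs_from N X (s + (N + b)%N%:Z) ws' w
  end.

(* The probability of a state is its long-run fraction of slots, so X is the
   radar observed in its time-stationary regime.  In that regime the backoff in
   progress in a given slot is size-biased; the backoffs are i.i.d. copies of W
   from any slot in which a packet starts, which is aloha_iid_backoff. *)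
Record aloha_radar (R : realType) d (T : measurableType d)
    (P : probability T R) d0 (T0 : measurableType d0) (P0 : probability T0 R)
    (N : nat) (W : T0 -> nat) (X : int -> T -> nat) : Prop := AlohaRadar {
  aloha_measurable : forall (t : int) (a : nat), measurable [set w | X t w = a] ;
  aloha_step : forall (t : int) (w : T),
    X (t + 1) w = (X t w).+1 \/ (X (t + 1) w = 0%N /\ (N <= (X t w).+1)%N) ;
  aloha_iid_backoff : forall (s : int) (ws : seq nat),
    Pr P [set w | backoffs_from N X s ws w] =
    Pr P (starts_packet X s) * \prod_(b <- ws) Pr P0 [set x | W x = b] ;
  aloha_longrun : forall (t : int) (a : nat),
    {ae P, forall w,
      (fun n : nat => (\sum_(k < n) (X k%:Z w == a)%:R) / n%:R : R) @ \oo -->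
      Pr P [set w' | X t w' = a]}
}.

Definition radar_events T (X : int -> T -> nat) : set (set T) :=
  <<s [set A | exists (t : int) (a : nat), A = [set w | X t w = a]] >>.

Definition mutually_independent (R : realType) d (T : measurableType d)
    (P : probability T R) (M : nat) (X : 'I_M -> int -> T -> nat) : Prop :=
  forall A : 'I_M -> set T, (forall j, radar_events (X j) (A j)) ->
    Pr P (\bigcap_j A j) = \prod_(j < M) Pr P (A j).

Definition aloha_network (R : realType) d (T : measurableType d)
    (P : probability T R) d0 (T0 : measurableType d0) (P0 : probability T0 R)
    (M N : nat) (W : T0 -> nat) (X : 'I_M -> int -> T -> nat) : Prop :=
  (forall j, aloha_radar P P0 N W (X j)) /\ mutually_independent P X.

(* The shift delta_1 of the other radar's chirps as received by the tagged
   radar: clock offset plus propagation time. *)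
Definition total_delay (R : realType) (c delta dist : R) : R :=
  delta + dist / c.

Definition start_event (R : realType) T (X : int -> T -> nat) (K : nat)
    (Delta delta1 : R) (t1 i : int) : set T :=
  starts_packet X (t1 + i * K%:Z - 1 - Num.floor (delta1 / Delta)) `|`
  starts_packet X (t1 + i * K%:Z + 1 - Num.ceil (delta1 / Delta)).

Definition chirp_shifts (L : nat) : set int :=
  [set i | - (L%:Z - 1) <= i <= L%:Z - 1].

Definition interference_event (R : realType) T (X : int -> T -> nat)
    (K L : nat) (Delta delta1 : R) (t1 : int) : set T :=
  \bigcup_(i in chirp_shifts L) start_event X K Delta delta1 t1 i.

Definition network_interference_event (R : realType) T (M : nat)
    (X : 'I_M -> int -> T -> nat) (tag : 'I_M) (K L : nat) (Delta : R)
    (delta1 : 'I_M -> R) (t1 : int) : set T :=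
  \bigcup_(j in [set j | j != tag])
    interference_event (X j) K L Delta (delta1 j) t1.

Definition mean (R : realType) d0 (T0 : measurableType d0)
    (P0 : probability T0 R) (W : T0 -> nat) : \bar R :=
  'E_P0[fun x => (W x)%:R].

Definition start_event_prob (R : realType) d0 (T0 : measurableType d0)
    (P0 : probability T0 R) (W : T0 -> nat) (K L : nat) : R :=
  let EW := fine (mean P0 W) in
  if (1 < K * L)%N then 2 / ((K * L)%:R + EW)
  else 1 / (1 + EW) + (1 - Pr P0 [set x | W x = 0%N]) / (L%:R + EW).

(* P(W = k) for k an integer, as k = -1 occurs in the formula below. *)
Definition backoff_law (R : realType) d0 (T0 : measurableType d0)
    (P0 : probability T0 R) (W : T0 -> nat) (k : int) : R :=
  Pr P0 [set x | (W x)%:Z = k].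

Definition two_radar_prob (R : realType) d0 (T0 : measurableType d0)
    (P0 : probability T0 R) (W : T0 -> nat) (K L : nat) : R :=
  let EW := fine (mean P0 W) in
  let pW := backoff_law P0 W in
  (2 * L%:R - 1) * start_event_prob P0 W K L -
  1 / ((K * L)%:R + EW) *
    \sum_(0 <= i < L.-1) (L - i - 1)%:R *
      (2 * pW (i * K)%:Z + pW ((i * K)%:Z + 1) + pW ((i * K)%:Z - 1)).

(* Main.v *)
(* Stationarity makes the law of the age X t independent of t, and the renewal
   structure gives P(X t = a) = P(X t = 0) P(a < N + W) with N = K L; summing
   over a yields P(X t = 0) = 1 / (N + E W).  Two starts less than 2 N slots
   apart are consecutive starts, so the probability of starts in slots s and
   s + m is P(X t = 0) P(W = m - N).  When the delay is not an integer number
   of slots, E_i is a start in one of two consecutive slots.  All the slots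
   involved lie among 2 N consecutive ones, which cannot hold three starts, so
   for K > 1 the inclusion-exclusion formula stops at pairs.  For K = 1 and
   L > 1 neighbouring E_i share a slot and that formula is not available; part
   (3) then only needs that the probability of their union is determined by the
   law of W, which holds since the union says that the age in the last of 2 L
   consecutive slots is less than 2 L. *)

Require Import Defs.
From HB Require Import structures.
From mathcomp Require Import all_boot all_order all_algebra.
From mathcomp Require Import all_classical all_reals all_analysis.
From mathcomp Require Import measurable_realfun.
From mathcomp Require Import zify ring.
Set Implicit Arguments.
Unset Strict Implicit.
Unset Printing Implicit Defensive.
Import Order.TTheory GRing.Theory Num.Theory.
Import numFieldNormedType.Exports.
Local Open Scope classical_set_scope.
Local Open Scope ring_scope.

(** * Finite additivity, truncated inclusion-exclusion and the tail-sum formula *)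

Section probability_lemmas.
Variables (d : measure_display) (T : measurableType d) (R : realType).
Variable P : probability T R.
Implicit Types A B : set T.

Lemma EFin_Pr A : measurable A -> (Pr P A)%:E = P A.
Proof. by move=> mA; rewrite /Pr fineK// fin_num_measure. Qed.

Lemma Pr_setT : Pr P setT = 1.
Proof. by rewrite /Pr probability_setT. Qed.

Lemma Pr_set0 : Pr P set0 = 0.
Proof. by rewrite /Pr measure0. Qed.

Lemma Pr_setC A : measurable A -> Pr P (~` A) = 1 - Pr P A.
Proof.
move=> mA; apply: EFin_inj.
by rewrite EFinB !EFin_Pr ?probability_setC//; exact: measurableC.
Qed.

Lemma Pr_setU A B : measurable A -> measurable B ->
  Pr P (A `|` B) = Pr P A + Pr P B - Pr P (A `&` B).
Proof.
move=> mA mB; apply: EFin_inj.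
rewrite EFinB EFinD !EFin_Pr//; [|exact: measurableI|exact: measurableU].
by rewrite measureUfinl// ltey_eq fin_num_measure.
Qed.

Lemma Pr_setU_disjoint A B : measurable A -> measurable B ->
  A `&` B = set0 -> Pr P (A `|` B) = Pr P A + Pr P B.
Proof. by move=> mA mB AB0; rewrite Pr_setU// AB0 Pr_set0 subr0. Qed.

Lemma bigcup_ltnS (F : nat -> set T) n :
  \bigcup_(i < n.+1) F i = (\bigcup_(i in `I_n) F i) `|` F n.
Proof. by rewrite !bigcup_mkord big_ord_recr. Qed.

Lemma Pr_bigcup_disjoint (F : nat -> set T) n :
  (forall i, measurable (F i)) ->
  (forall i j, (i < j < n)%N -> F i `&` F j = set0) ->
  Pr P (\bigcup_(i < n) F i) = \sum_(i < n) Pr P (F i).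
Proof.
move=> mF; elim: n => [|n IHn] F0.
  by rewrite big_ord0 (_ : \bigcup_(i in _) _ = set0) ?Pr_set0// bigcup0.
rewrite bigcup_ltnS big_ord_recr/= Pr_setU_disjoint//.
- by rewrite IHn// => i j /andP[ij jn]; apply: F0; rewrite ij ltnW.
- exact: bigcup_measurable.
- rewrite setI_bigcupl; apply: bigcup0 => i /= ilt.
  by apply: F0; rewrite ilt leqnn.
Qed.

(* Bonferroni truncates after the second-order terms when at most two of the
   events can occur together. *)
Lemma Pr_bigcup_pairwise (F : nat -> set T) n :
  (forall i, measurable (F i)) ->
  (forall i j k, (i < j)%N -> (j < k < n)%N -> F i `&` F j `&` F k = set0) ->
  Pr P (\bigcup_(i < n) F i) =
  \sum_(j < n) Pr P (F j) - \sum_(j < n) \sum_(i < j) Pr P (F i `&` F j).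
Proof.
move=> mF; elim: n => [|n IHn] F0.
  by rewrite !big_ord0 subr0 (_ : \bigcup_(i in _) _ = set0) ?Pr_set0// bigcup0.
rewrite bigcup_ltnS !big_ord_recr/= Pr_setU//; last exact: bigcup_measurable.
rewrite IHn; last first.
  by move=> i j k ij /andP[jk kn]; apply: F0; rewrite // jk ltnW.
rewrite setI_bigcupl Pr_bigcup_disjoint; first by rewrite opprD; ring.
- by move=> i; exact: measurableI.
- move=> i j /andP[ij jn].
  by rewrite setIACA setIid F0// jn ltnSn.
Qed.

(** At each point, [Y x] counts the [n] below it; nonnegativity allows sum and integral to be
    exchanged. *)
Lemma nneseries_tail (Y : T -> nat) :
  (forall n, measurable [set x | (n < Y x)%N]) ->
  (\sum_(0 <= n <oo) P [set x | (n < Y x)%N] = \int[P]_x ((Y x)%:R)%:E)%E.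
Proof.
move=> mY.
transitivity (\sum_(0 <= n <oo)
    \int[P]_x (\1_[set x | (n < Y x)%N] x)%:E)%E.
  by apply: eq_eseriesr => n _; rewrite integral_indic// setIT.
rewrite -integral_nneseries//.
- apply: eq_integral => x _.
  rewrite (nneseries_split 0 (Y x))//.
  rewrite add0n eseries0 ?adde0; last first.
    by move=> n Yn _; rewrite indicE memNset//=; apply/negP; rewrite -leqNgt.
  rewrite big_mkord (eq_bigr (fun=> 1%E)).
    by rewrite sumEFin sumr_const card_ord.
  by move=> i _; rewrite indicE mem_set/=.
- by move=> n; apply/measurable_EFinP; exact: measurable_indic.
Qed.

End probability_lemmas.

(** * Deterministic properties of one path of ages *)

Section radar_path.
Variables (N : nat) (x : int -> nat).
Hypothesis x_step :
  forall t, x (t + 1) = (x t).+1 \/ (x (t + 1) = 0%N /\ (N <= (x t).+1)%N).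

(** A positive age cannot result from a reset, so it was one less in the slot before; iterating
    leads back to the start of the cycle. *)
Lemma age_backward s a : x (s + a%:Z) = a ->
  forall k, (k <= a)%N -> x (s + k%:Z) = k.
Proof.
elim: a => [|a IHa] xa k; first by rewrite leqn0 => /eqP->.
rewrite leq_eqVlt => /predU1P[->//|]; rewrite ltnS; apply: IHa.
move: xa; rewrite -addn1 PoszD addrA.
by case: (x_step (s + a%:Z)) => [->|[-> _]]; rewrite addn1// => -[].
Qed.

Lemma age_le s m : (x (s + m%:Z) <= x s + m)%N.
Proof.
elim: m => [|m IHm]; first by rewrite addr0 addn0.
rewrite -[in leqLHS]addn1 PoszD addrA.
by case: (x_step (s + m%:Z)) => [->|[-> _]]//; rewrite addnS ltnS.
Qed.

(** A reset requires [N <= (x t).+1], so none occurs during the packet. *)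
Lemma age_packet s k : x s = 0%N -> (k < N)%N -> x (s + k%:Z) = k.
Proof.
move=> x0; elim: k => [|k IHk] kN; first by rewrite addr0.
rewrite -addn1 PoszD addrA.
by case: (x_step (s + k%:Z)) => [->|[_]]; rewrite IHk ?addn1//; lia.
Qed.

Lemma starts_separated s m : x s = 0%N -> x (s + m%:Z) = 0%N ->
  (0 < m)%N -> (N <= m)%N.
Proof.
by move=> x0 xm m0; case: leqP => // /(age_packet x0); rewrite xm => m0'; lia.
Qed.

(** A start strictly in between would be at least [N] slots from both ends. *)
Lemma starts_consecutive s m : x s = 0%N -> x (s + m%:Z) = 0%N ->
  (m < N + N)%N -> forall k, (k < m)%N -> x (s + k%:Z) = k.
Proof.
move=> x0 xm mN; elim=> [|k IHk] km; first by rewrite addr0.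
have xk := IHk (ltnW km).
case: (x_step (s + k%:Z)); rewrite -addrA -PoszD addn1 xk => // -[xk1 Nk].
have xm1 : x (s + k.+1%:Z + (m - k.+1)%:Z) = 0%N.
  by rewrite -addrA -PoszD subnKC// ltnW.
by have := starts_separated xk1 xm1; lia.
Qed.

End radar_path.

(** * Law of the age of one radar, and of pairs of starts *)

Section single_radar.
Variables (R : realType) (d : measure_display) (T : measurableType d).
Variables (P : probability T R) (d0 : measure_display).
Variables (T0 : measurableType d0) (P0 : probability T0 R).
Variables (N : nat) (W : {RV P0 >-> nat}) (X : int -> T -> nat).
Hypotheses (N_gt0 : (0 < N)%N) (radar : aloha_radar P P0 N W X).

Let X_step w t :
  X (t + 1) w = (X t w).+1 \/ (X (t + 1) w = 0%N /\ (N <= (X t w).+1)%N).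
Proof. exact: (aloha_step radar). Qed.

Lemma measurable_backoff (A : set nat) : measurable [set y | A (W y)].
Proof. exact: measurable_funPTI. Qed.

Lemma measurable_starts s : measurable (starts_packet X s).
Proof. exact: (aloha_measurable radar). Qed.

(** The same long-run fraction converges almost surely to both sides; a sample point common to the
    two almost sure events exists, and limits are unique. *)
Lemma Pr_age_stationary t t' a :
  Pr P [set w | X t w = a] = Pr P [set w | X t' w = a].
Proof.
have aeP : ProperFilter (almost_everywhere P).
  apply: ae_properfilter_algebraOfSetsType.
  by rewrite /= probability_setT.
have [w [limt limt']] :=
  filter_ex (filterI (aloha_longrun radar t a) (aloha_longrun radar t' a)).
exact: cvg_unique limt limt'.
Qed.

Lemma starts_age s a w : X (s + a%:Z) w = a -> X s w = 0%N.
Proof.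
by move=> /(age_backward (X_step w))/(_ 0%N (leq0n _)); rewrite addr0.
Qed.

Lemma measurable_backoffs_from s ws :
  measurable [set w | backoffs_from N X s ws w].
Proof.
elim: ws s => [|b ws IHws] s /=; first exact: measurable_starts.
apply: measurableI; last exact: IHws.
rewrite [X in measurable X](_ : _ =
    \bigcap_(k < N + b) [set w | X (s + k%:Z) w = k]).
  by apply: bigcap_measurableType => k _; exact: (aloha_measurable radar).
by [].
Qed.

Lemma Pr_age s a : Pr P [set w | X (s + a%:Z) w = a] =
  Pr P (starts_packet X s) * Pr P0 [set y | (a < N + W y)%N].
Proof.
elim: a => [|a IHa].
  rewrite addr0 (_ : [set y | (0 < N + W y)%N] = setT) ?Pr_setT ?mulr1//.
  by apply/seteqP; split => // y _ /=; rewrite ltn_addr.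
have mX t b := aloha_measurable radar t b.
have [aN|Na] := ltnP a.+1 N.
  rewrite (_ : [set w | X (s + a.+1%:Z) w = a.+1] =
    [set w | X (s + a%:Z) w = a]).
    rewrite IHa; congr (_ * Pr P0 _).
    by apply/seteqP; split => y /= _; rewrite ltn_addr// ltnW.
  apply/seteqP; split => w /=.
    by move=> /(age_backward (X_step w))/(_ a (leqnSn a)).
  by move=> /starts_age/(age_packet (X_step w)); apply.
have [b bE] : exists b, a.+1 = (N + b)%N by exists (a.+1 - N)%N; rewrite subnKC.
(* Age [a] is followed either by age [a.+1] or by a new start, and the latter means that the cycle
   had backoff exactly [b]. The tail event of [N + W] splits in parallel, so the [b] terms
   cancel. *)
have splitX : [set w | X (s + a%:Z) w = a] =
    [set w | X (s + a.+1%:Z) w = a.+1] `|`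
    [set w | backoffs_from N X s [:: b] w].
  apply/seteqP; split => w /=; rewrite -bE.
    move=> xa; case: (X_step w (s + a%:Z)).
      by rewrite xa -addrA -PoszD addn1; left.
    rewrite xa -addrA -PoszD addn1 => -[-> _]; right; split => // k.
    by rewrite ltnS; exact: (age_backward (X_step w)).
  move=> [/(age_backward (X_step w))|[]]; first by apply.
  by move=> + _; apply.
have splitW : [set y | (a < N + W y)%N] =
    [set y | (a.+1 < N + W y)%N] `|` [set y | W y = b].
  apply/seteqP; split => y /=.
    by rewrite leq_eqVlt => /predU1P[|]; [right; lia|left].
  by case; [exact: ltnW|move=> ->; rewrite bE].
move: IHa; rewrite splitX splitW !Pr_setU_disjoint//.
- rewrite (aloha_iid_backoff radar) big_seq1 mulrDr.
  by move/addIr.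
- exact: measurable_backoff (fun n => (a.+1 < N + n)%N).
- exact: measurable_backoff [set b].
- by apply/seteqP; split => // y /= [+ Wb]; rewrite Wb; lia.
- exact: measurable_backoffs_from.
- apply/seteqP; split => // w /= [+ [_ +]]; rewrite bE => -> ; lia.
Qed.

Lemma integral_cycle_length :
  (\int[P0]_y ((N + W y)%N%:R)%:E = N%:R%:E + mean P0 W)%E.
Proof.
under eq_integral do rewrite natrD EFinD.
rewrite ge0_integralD//.
- by rewrite integral_cst//= probability_setT mule1 /mean unlock.
- apply/measurable_EFinP.
  by apply: (measurableT_comp (f := fun n : nat => n%:R : R)).
Qed.

Lemma Pr_starts s : (mean P0 W < +oo)%E ->
  Pr P (starts_packet X s) = 1 / (N%:R + fine (mean P0 W)).
Proof.
move=> EW_fin.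
have EW_ge0 : (0 <= mean P0 W)%E.
  by rewrite /mean unlock integral_ge0// => y _; rewrite lee_fin.
have EWE : mean P0 W = (fine (mean P0 W))%:E.
  by rewrite fineK// ge0_fin_numE.
have mage n : measurable [set y | (n < N + W y)%N].
  exact: measurable_backoff (fun m => (n < N + m)%N).
have : 1%E = ((Pr P (starts_packet X s))%:E * (N%:R%:E + mean P0 W))%E.
  rewrite -integral_cycle_length -nneseries_tail// -nneseriesZl//.
  rewrite -(probability_setT P).
  rewrite (_ : setT = \bigcup_a [set w | X 0 w = a]); last first.
    by apply/seteqP; split => // w _; exists (X 0 w).
  rewrite measure_semi_bigcup//.
  - apply: eq_eseriesr => a _.
    rewrite /= -(EFin_Pr P (aloha_measurable radar 0 a)).
    (* Slot 0 is traded for slot [s + a], so that every term refers to a start in the same slot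
       [s]. *)
    rewrite (Pr_age_stationary 0 (s + a%:Z)) Pr_age EFinM; congr (_ * _)%E.
    exact: EFin_Pr.
  - by move=> a; exact: (aloha_measurable radar).
  - by apply/trivIsetP => i j _ _ ij; apply/seteqP; split => // w /=
      [-> /eqP]; rewrite (negPf ij).
  - by apply: bigcup_measurable => a _; exact: (aloha_measurable radar).
rewrite {1}EWE -EFinD -EFinM => -[E1].
apply: (canRL (mulfK _)) => //.
by rewrite lt0r_neq0// ltr_pwDl ?ltr0n// fine_ge0.
Qed.

(** For [m < N] both sides vanish. Otherwise the two starts are consecutive and enclose one cycle of
    backoff [m - N]. *)
Lemma Pr_two_starts s m : (0 < m < N + N)%N ->
  Pr P (starts_packet X s `&` starts_packet X (s + m%:Z)) =
  Pr P (starts_packet X s) * backoff_law P0 W (m%:Z - N%:Z).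
Proof.
clear N_gt0; move=> /andP[m0 mN]; have [ltmN|leNm] := ltnP m N.
  rewrite (_ : _ `&` _ = set0).
    rewrite /backoff_law (_ : [set y | (W y)%:Z = _] = set0) ?Pr_set0 ?mulr0//.
    by apply/seteqP; split => // y /= ; lia.
  apply/seteqP; split => // w [sw mw].
  by have := starts_separated (X_step w) sw mw m0; rewrite leqNgt ltmN.
have [b mE] : exists b, m = (N + b)%N by exists (m - N)%N; rewrite subnKC.
rewrite {}mE in m0 mN leNm *.
rewrite (_ : _ `&` _ = [set w | backoffs_from N X s [:: b] w]).
  rewrite (aloha_iid_backoff radar) big_seq1; congr (_ * Pr P0 _).
  by apply/seteqP; split => y /=; lia.
apply/seteqP; split => w /= [sw mw]; split => //.
  by apply: (starts_consecutive (X_step w) sw mw); lia.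
by have := sw 0%N; rewrite addr0; apply; lia.
Qed.

End single_radar.

(** * Windows of two adjacent slots: pair probabilities and the law of their union *)

Lemma Pr_setIUU (R : realType) d (T : measurableType d) (P : probability T R)
    (A1 A2 B1 B2 : set T) :
  measurable A1 -> measurable A2 -> measurable B1 -> measurable B2 ->
  A1 `&` A2 = set0 -> B1 `&` B2 = set0 ->
  Pr P ((A1 `|` A2) `&` (B1 `|` B2)) =
  Pr P (A1 `&` B1) + Pr P (A1 `&` B2) + (Pr P (A2 `&` B1) + Pr P (A2 `&` B2)).
Proof.
move=> mA1 mA2 mB1 mB2 A0 B0; have mI := @measurableI _ T.
rewrite setIUl Pr_setU_disjoint; last first.
- by rewrite setIACA A0 set0I.
- by apply: mI => //; exact: measurableU.
- by apply: mI => //; exact: measurableU.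
have PrIU A : measurable A ->
    Pr P (A `&` (B1 `|` B2)) = Pr P (A `&` B1) + Pr P (A `&` B2).
  move=> mA; rewrite setIUr Pr_setU_disjoint//; [exact: mI|exact: mI|].
  by rewrite setIACA B0 setI0.
by rewrite !PrIU.
Qed.

(** Exactly [n - m] pairs [i < j < n] have difference [m]. *)
Lemma sum_differences (R : pzRingType) (g : nat -> R) n :
  \sum_(j < n) \sum_(i < j) g (j - i)%N = \sum_(1 <= m < n) (n - m)%:R * g m.
Proof.
elim: n => [|n IHn]; first by rewrite big_ord0 big_geq.
have gapE : \sum_(i < n) g (n - i)%N = \sum_(1 <= m < n.+1) g m.
  rewrite -(big_mkord xpredT (fun i => g (n - i)%N)) big_nat_rev/= big_add1/=.
  by rewrite !big_nat; apply: eq_bigr => i /andP[_ ilt]; congr (g _); lia.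
rewrite big_ord_recr/= IHn gapE; case: n {IHn gapE} => [|n].
  by rewrite !big_geq// addr0.
rewrite !(@big_nat_recr _ _ _ n.+1)//= addrA -big_split/= subSnn mul1r.
congr (_ + _); rewrite !big_nat; apply: eq_bigr => m /andP[m0 mn].
have -> : (n.+2 - m = (n.+1 - m).+1)%N by lia.
by rewrite -natr1 mulrDl mul1r.
Qed.

Lemma backoff_law_lt0 (R : realType) d0 (T0 : measurableType d0)
  (P0 : probability T0 R) (W : T0 -> nat) k : k < 0 -> backoff_law P0 W k = 0.
Proof.
move=> k0; rewrite /backoff_law (_ : [set x | _] = set0) ?Pr_set0//.
by apply/seteqP; split => // y /= Wk; move: k0; rewrite -Wk.
Qed.

(** The events [E_i], for a delay that is not a whole number of slots, indexed from zero. *)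
Definition start_window T (X : int -> T -> nat) (K : nat) (s : int) (j : nat) :=
  starts_packet X (s + (j * K)%:Z) `|` starts_packet X (s + (j * K)%:Z + 1).

Section start_windows.
Variables (R : realType) (d : measure_display) (T : measurableType d).
Variables (P : probability T R) (d0 : measure_display).
Variables (T0 : measurableType d0) (P0 : probability T0 R).
Variables (K L : nat) (W : {RV P0 >-> nat}) (X : int -> T -> nat).
Hypotheses (K_gt0 : (0 < K)%N) (L_gt0 : (0 < L)%N).
Hypothesis EW_fin : (mean P0 W < +oo)%E.
Hypothesis radar : aloha_radar P P0 (K * L) W X.

Let N_gt0 : (0 < K * L)%N. Proof. by rewrite muln_gt0 K_gt0. Qed.

Let rho := 1 / ((K * L)%:R + fine (mean P0 W)).

(** Starts in both slots have probability proportional to [P(W = 1 - K L)], which is zero unless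
    [K L = 1]; hence the two cases of [q]. *)
Lemma Pr_start_pair s :
  Pr P (starts_packet X s `|` starts_packet X (s + 1)) =
  start_event_prob P0 W K L.
Proof.
have mS := measurable_starts radar.
rewrite Pr_setU// (Pr_two_starts radar s (m := 1%N)); last by lia.
rewrite !(Pr_starts N_gt0 radar)// /start_event_prob.
case: ltnP => [N1|N1]; first by rewrite backoff_law_lt0; [ring|lia].
have [-> ->] : K = 1%N /\ L = 1%N by nia.
rewrite mul1n subrr (_ : backoff_law P0 W 0 = Pr P0 [set x | W x = 0%N]).
  by ring.
by congr (Pr P0 _); apply/seteqP; split => y /=; lia.
Qed.

Lemma measurable_start_window s j : measurable (start_window X K s j).
Proof. by apply: measurableU; exact: (measurable_starts radar). Qed.

(** As [K > 1], distinct windows give distinct starts, so three of them span at least [2 * K * L]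
    slots, while offsets within the windows reach at most [(2 * L - 2) * K + 1]. *)
Lemma no_three_windows s i j k : (1 < K)%N -> (i < j)%N ->
  (j < k < (2 * L).-1)%N ->
  start_window X K s i `&` start_window X K s j `&` start_window X K s k = set0.
Proof.
move=> K1 ij /andP[jk kL]; apply/seteqP; split => // w [[wi wj] wk].
have window_offset l : start_window X K s l w ->
    exists e, (e <= 1)%N /\ X (s + (l * K + e)%:Z) w = 0%N.
  by case=> sl; [exists 0%N|exists 1%N]; rewrite ?addn0// PoszD addrA.
have {wi}[e1 [e1le s1]] := window_offset _ wi.
have {wj}[e2 [e2le s2]] := window_offset _ wj.
have {wk}[e3 [e3le s3]] := window_offset _ wk.
have separated a b : X (s + a%:Z) w = 0%N -> X (s + b%:Z) w = 0%N ->
    (a < b)%N -> (K * L <= b - a)%N.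
  move=> sa sb ab.
  apply: (starts_separated (fun t => aloha_step radar t w) sa); last by lia.
  by rewrite -addrA -PoszD subnKC// ltnW.
(* Naming the index gaps [u.+1] and [v.+1] makes the final inequality linear in the products with
   [K]. *)
have [u uE] : exists u, j = (i + u.+1)%N by exists (j - i).-1; lia.
have [v vE] : exists v, k = (j + v.+1)%N by exists (k - j).-1; lia.
have jK : (j * K = i * K + u * K + K)%N by rewrite uE mulnDl mulSn; lia.
have kK : (k * K = j * K + v * K + K)%N by rewrite vE mulnDl mulSn; lia.
have := separated _ _ s1 s2; have := separated _ _ s2 s3.
have uvL : (u + v + 4 <= 2 * L)%N by lia.
have : ((u + v + 4) * K <= 2 * L * K)%N by rewrite leq_mul2r uvL orbT.
have -> : ((u + v + 4) * K = u * K + v * K + 4 * K)%N by rewrite !mulnDl.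
by have -> : (2 * L * K = 2 * (K * L))%N; lia.
Qed.

(** Windows [m] indices apart have four pairs of slots, at distances [m * K] (twice), [m * K + 1]
    and [m * K - 1]; the packet length is subtracted to get the backoff. *)
Let gap_law (m : nat) : R :=
  2 * backoff_law P0 W ((m * K)%:Z - (K * L)%:Z) +
  backoff_law P0 W ((m * K)%:Z + 1 - (K * L)%:Z) +
  backoff_law P0 W ((m * K)%:Z - 1 - (K * L)%:Z).

Lemma Pr_two_windows s i j : (1 < K)%N -> (i < j < (2 * L).-1)%N ->
  Pr P (start_window X K s i `&` start_window X K s j) = rho * gap_law (j - i).
Proof.
move=> K1 /andP[ij jL].
have next_disjoint t : starts_packet X t `&` starts_packet X (t + 1) = set0.
  apply/seteqP; split => // w [t0 t1].
  by have := starts_separated (fun u => aloha_step radar u w) t0 t1; nia.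
have mS := measurable_starts radar.
rewrite Pr_setIUU// /gap_law.
set m := ((j - i) * K)%N; set a := s + (i * K)%:Z.
(* These bounds keep the distances [m - 1], [m] and [m + 1] in the range of [Pr_two_starts]. *)
have m_gt1 : (1 < m)%N by rewrite /m; nia.
have m_lt : (m.+1 < K * L + K * L)%N by rewrite /m; nia.
have -> : s + (j * K)%:Z = a + m%:Z.
  by rewrite /a -addrA -PoszD -mulnDl subnKC// ltnW.
have two t l : (0 < l < m.+2)%N ->
    Pr P (starts_packet X t `&` starts_packet X (t + l%:Z)) =
    rho * backoff_law P0 W (l%:Z - (K * L)%:Z).
  move=> /andP[l0 lm].
  by rewrite (Pr_two_starts radar) ?(Pr_starts N_gt0 radar)//; lia.
have aa : Pr P (starts_packet X a `&` starts_packet X (a + m%:Z)) =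
    rho * backoff_law P0 W (m%:Z - (K * L)%:Z).
  by apply: two; lia.
have ab : Pr P (starts_packet X a `&` starts_packet X (a + m%:Z + 1)) =
    rho * backoff_law P0 W (m%:Z + 1 - (K * L)%:Z).
  by rewrite -addrA -PoszD; apply: two; lia.
have ba : Pr P (starts_packet X (a + 1) `&` starts_packet X (a + m%:Z)) =
    rho * backoff_law P0 W (m%:Z - 1 - (K * L)%:Z).
  have -> : a + m%:Z = a + 1 + m.-1%:Z by lia.
  have -> : m%:Z - 1 = m.-1%:Z by lia.
  by apply: two; lia.
have bb : Pr P (starts_packet X (a + 1) `&` starts_packet X (a + m%:Z + 1)) =
    rho * backoff_law P0 W (m%:Z - (K * L)%:Z).
  by rewrite [a + _ + 1]addrAC; apply: two; lia.
by rewrite aa ab ba bb; ring.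
Qed.

Lemma Pr_start_windows s : (1 < K)%N ->
  Pr P (\bigcup_(j < (2 * L).-1) start_window X K s j) =
  two_radar_prob P0 W K L.
Proof.
move=> K1; rewrite Pr_bigcup_pairwise; last first.
- by move=> i j k; exact: no_three_windows.
- exact: measurable_start_window.
under eq_bigr do rewrite Pr_start_pair.
rewrite sumr_const card_ord /two_radar_prob -/rho.
under eq_bigr => j _.
  under eq_bigr => i _ do rewrite Pr_two_windows ?ltn_ord//.
  rewrite -mulr_sumr; over.
rewrite -mulr_sumr sum_differences.
(* For gaps below [L] all arguments of [backoff_law] are negative, as [K > 1]. A gap [r + L] has
   weight [(2 * L).-1 - (r + L)], that is [L - r - 1]. *)
rewrite (big_cat_nat (n := L))//=; last by lia.
rewrite big_nat big1 ?add0r; last first.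
  move=> m /andP[m0 mL]; have mKL : (m * K + K <= K * L)%N by nia.
  by rewrite /gap_law !backoff_law_lt0 ?mulr0 ?addr0 ?mulr0//; lia.
have -> (F : nat -> R) :
    \sum_(L <= m < (2 * L).-1) F m = \sum_(0 <= r < L.-1) F (r + L)%N.
  by rewrite -{1}[L]add0n big_addn (_ : (2 * L).-1 - L = L.-1)%N; last lia.
congr (_ - _ * _).
  rewrite -[LHS]mulr_natl; congr (_ * _).
  by rewrite -(natrM _ 2 L) -subn1 natrB//; lia.
rewrite !big_nat; apply: eq_bigr => i /andP[_ iL].
congr (_%:R * _); first by lia.
rewrite /gap_law (_ : ((i + L) * K)%:Z = (i * K)%:Z + (K * L)%:Z); last by lia.
by congr (_ * _ + _ + _); congr (backoff_law _ _ _); lia.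
Qed.

(* Of 2 L consecutive slots, one starts a packet if and only if the age in the
   last one is less than 2 L. *)
Lemma Pr_start_windows_unit_chirp s : K = 1%N ->
  Pr P (\bigcup_(j < (2 * L).-1) start_window X K s j) =
  \sum_(a < 2 * L) rho * Pr P0 [set y | (a < K * L + W y)%N].
Proof.
move=> K1; pose e := s + (2 * L).-1%:Z.
rewrite (_ : \bigcup_(j < _) _ = \bigcup_(a < 2 * L) [set w | X e w = a]).
  rewrite Pr_bigcup_disjoint.
  - apply: eq_bigr => a _.
    rewrite (Pr_age_stationary radar e (0 + a%:Z)) (Pr_age N_gt0 radar).
    by rewrite (Pr_starts N_gt0 radar).
  - by move=> a; exact: (aloha_measurable radar).
  - move=> i j /andP[ij _]; apply/seteqP; split => // w /= [-> ji].
    by rewrite ji ltnn in ij.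
have X_step t w := aloha_step radar t w.
apply/seteqP; split => w /=.
  move=> [j /= jL] sj.
  have [i [iL si]] : exists i, (i < 2 * L)%N /\ X (s + i%:Z) w = 0%N.
    case: sj; rewrite K1 muln1 => sj; first by exists j; split => //; lia.
    by exists j.+1; split; [lia|rewrite -addn1 PoszD addrA].
  exists (X e w) => //=.
  have := age_le (fun t => X_step t w) (s + i%:Z) ((2 * L).-1 - i).
  by rewrite si (_ : s + i%:Z + _ = e); rewrite /e; lia.
move=> [a /= aL] ea.
have sa : X (e - a%:Z) w = 0%N.
  by apply: (starts_age radar (a := a)); rewrite subrK.
(* A start in the last slot [e] is the second slot of the last window; an earlier one is the first
   slot of a window. *)
case: a aL ea sa => [|a] aL ea sa.
  exists (2 * L).-2 => /=; first by lia.
  right; rewrite /starts_packet/= K1 muln1 -[RHS]sa; congr (X _ w).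
  by rewrite /e; lia.
exists ((2 * L).-1 - a.+1)%N => /=; first by lia.
left; rewrite /starts_packet/= K1 muln1 -[RHS]sa; congr (X _ w).
by rewrite /e; lia.
Qed.

(** A value depending only on [K], [L] and the law of [W], which lets different radars and
    probability spaces be compared for every [K]. *)
Definition interference_law (R : realType) d0 (T0 : measurableType d0)
    (P0 : probability T0 R) (W : T0 -> nat) (K L : nat) : R :=
  if (1 < K)%N then two_radar_prob P0 W K L else
  \sum_(a < 2 * L) 1 / ((K * L)%:R + fine (mean P0 W)) *
    Pr P0 [set y | (a < K * L + W y)%N].

Lemma Pr_start_windows_law s :
  Pr P (\bigcup_(j < (2 * L).-1) start_window X K s j) =
  interference_law P0 W K L.
Proof.
rewrite /interference_law; case: ltnP => [|K1]; first exact: Pr_start_windows.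
by apply: Pr_start_windows_unit_chirp; apply/eqP; rewrite eqn_leq K1.
Qed.

End start_windows.

(** * From the events [E_i] to windows *)

Section received_shifts.
Variables (R : realType) (T : Type) (X : int -> T -> nat) (K L : nat).
Variables (Delta delta1 : R) (t1 : int).
Hypotheses (L_gt0 : (0 < L)%N) (delay_nint : delta1 / Delta \isn't a Num.int).

Lemma start_eventE i : start_event X K Delta delta1 t1 i =
  starts_packet X (t1 + i * K%:Z - 1 - Num.floor (delta1 / Delta)) `|`
  starts_packet X (t1 + i * K%:Z - 1 - Num.floor (delta1 / Delta) + 1).
Proof.
clear L_gt0.
have ceilE : Num.ceil (delta1 / Delta) = Num.floor (delta1 / Delta) + 1.
  by rewrite ceil_floor delay_nint.
by rewrite /start_event ceilE; congr (_ `|` starts_packet X _); lia.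
Qed.

(** The shift [i] becomes the index [i + L - 1], and the base slot is the first slot of the event
    with [i = -(L - 1)]. *)
Lemma interference_eventE : interference_event X K L Delta delta1 t1 =
  \bigcup_(j < (2 * L).-1) start_window X K
    (t1 - 1 - Num.floor (delta1 / Delta) - ((L.-1) * K)%:Z) j.
Proof.
have windowE j : start_event X K Delta delta1 t1 (j%:Z - L.-1%:Z) =
    start_window X K (t1 - 1 - Num.floor (delta1 / Delta) - ((L.-1) * K)%:Z) j.
  rewrite start_eventE /start_window.
  by congr (starts_packet X _ `|` starts_packet X _); lia.
apply/seteqP; split => w [].
  move=> i /= /andP[iL Li] wi; exists (absz (i + L.-1%:Z)) => /=; first by lia.
  rewrite -windowE; move: wi; congr (start_event _ _ _ _ _ _ w).
  by lia.
move=> j /= jL; rewrite -windowE => wj; exists (j%:Z - L.-1%:Z) => //.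
by rewrite /chirp_shifts/=; lia.
Qed.

End received_shifts.

(** * Independence of the radars and the network formula *)

Lemma radar_events_interference (R : realType) d (T : measurableType d)
    (X : int -> T -> nat) (K L : nat) (Delta delta1 : R) (t1 : int) :
  (0 < L)%N -> delta1 / Delta \isn't a Num.int ->
  radar_events X (interference_event X K L Delta delta1 t1).
Proof.
move=> L_gt0 nint; rewrite interference_eventE// /radar_events.
set G := [set A | _]; set A := \bigcup_(j < _) _.
have starts_G s : measurable (starts_packet X s : set (g_sigma_algebraType G)).
  by apply: sub_sigma_algebra; exists s, 0%N.
suff : measurable (A : set (g_sigma_algebraType G)) by [].
by apply: bigcup_measurable => j _; exact: measurableU.
Qed.

Lemma radar_events_measurable (R : realType) d (T : measurableType d)
    (P : probability T R) d0 (T0 : measurableType d0) (P0 : probability T0 R)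
    (N : nat) (W : T0 -> nat) (X : int -> T -> nat) :
  aloha_radar P P0 N W X -> radar_events X `<=` measurable.
Proof.
move=> radar; apply: smallest_sub; first exact: sigma_algebra_measurable.
by move=> _ [t [a ->]]; exact: (aloha_measurable radar).
Qed.

Lemma Pr_interference (R : realType) d (T : measurableType d)
    (P : probability T R) d0 (T0 : measurableType d0) (P0 : probability T0 R)
    (K L : nat) (W : {RV P0 >-> nat}) (X : int -> T -> nat)
    (Delta delta1 : R) (t1 : int) :
  (0 < K)%N -> (0 < L)%N -> (mean P0 W < +oo)%E ->
  aloha_radar P P0 (K * L) W X -> delta1 / Delta \isn't a Num.int ->
  Pr P (interference_event X K L Delta delta1 t1) = interference_law P0 W K L.
Proof.
move=> K0 L0 EW radar nint.
rewrite interference_eventE//.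
exact: (Pr_start_windows_law K0 L0 EW radar).
Qed.

Lemma Pr_network_interference (R : realType) d (T : measurableType d)
    (P : probability T R) d0 (T0 : measurableType d0) (P0 : probability T0 R)
    (M K L : nat) (W : {RV P0 >-> nat}) (X : 'I_M -> int -> T -> nat)
    (tag : 'I_M) (Delta : R) (delta1 : 'I_M -> R) (t1 : int) :
  (0 < K)%N -> (0 < L)%N -> (mean P0 W < +oo)%E ->
  aloha_network P P0 (K * L) W X ->
  (forall j, j != tag -> delta1 j / Delta \isn't a Num.int) ->
  Pr P (network_interference_event X tag K L Delta delta1 t1) =
  1 - (1 - interference_law P0 W K L) ^+ M.-1.
Proof.
move=> K0 L0 EW [radars indep] nint.
pose I j := interference_event (X j) K L Delta (delta1 j) t1.
have evI j : j != tag -> radar_events (X j) (I j).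
  by move=> jt; apply: radar_events_interference => //; exact: nint.
have mI j : j != tag -> measurable (I j).
  by move=> /evI; exact: (radar_events_measurable (radars j)).
(* Independence concerns all [M] radars, so the tagged one receives the sure event and contributes a
   factor 1. *)
pose A j := if j == tag then setT else ~` I j.
have evA j : radar_events (X j) (A j).
  rewrite /A; case: eqVneq => [_|/evI Ij]; last exact: sigma_algebraC.
  by rewrite -setC0; apply: sigma_algebraC; exact: sigma_algebra0.
have networkE : network_interference_event X tag K L Delta delta1 t1 =
    ~` \bigcap_j A j.
  rewrite setC_bigcap; apply/seteqP; split => w [j].
    by move=> /= jt Ij; exists j => //; rewrite /A (negPf jt) setCK.
  move=> _; rewrite /A; case: eqVneq => [_|jt]; first by rewrite setCT.
  by rewrite setCK; exists j.
rewrite networkE Pr_setC; last first.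
  apply: fin_bigcap_measurable => [|j _]; first exact: finite_finset.
  exact: (radar_events_measurable (radars j)).
rewrite indep// (bigD1 tag)//= {1}/A eqxx Pr_setT mul1r.
rewrite (eq_bigr (fun=> 1 - interference_law P0 W K L)) => [|j jt]; last first.
  rewrite /A (negPf jt) (Pr_setC P (mI j jt)) /I.
  by rewrite (Pr_interference _ K0 L0 EW (radars j))// nint.
by rewrite prodr_const cardC1 card_ord.
Qed.

Theorem proposition2 (R : realType) (K L M : nat)
  (K_gt0 : (0 < K)%N) (L_gt0 : (0 < L)%N) (M_gt0 : (0 < M)%N)
  (Delta c : R) (Delta_gt0 : 0 < Delta) (c_gt0 : 0 < c)
  (d0 : measure_display) (T0 : measurableType d0) (P0 : probability T0 R)
  (W : {RV P0 >-> nat}) (EW_fin : (mean P0 W < +oo)%E)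
  (t1 : int)
  (* a two-radar network: tagged radar tag2, interfering radar j2 *)
  (d2 : measure_display) (T2 : measurableType d2) (P2 : probability T2 R)
  (X2 : 'I_2 -> int -> T2 -> nat) (net2 : aloha_network P2 P0 (K * L) W X2)
  (tag2 j2 : 'I_2) (j2_neq : j2 != tag2)
  (delta2 dist2 : R) (delta2_bnd : 0 < delta2 < Delta) (dist2_ge0 : 0 <= dist2)
  (delay2_nint : total_delay c delta2 dist2 / Delta \isn't a Num.int)
  (* an M-radar network: tagged radar tag, interfering radars j != tag *)
  (d : measure_display) (T : measurableType d) (P : probability T R)
  (X : 'I_M -> int -> T -> nat) (net : aloha_network P P0 (K * L) W X)
  (tag : 'I_M) (delta dist : 'I_M -> R)
  (delta_bnd : forall j, j != tag -> 0 < delta j < Delta)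
  (dist_ge0 : forall j, j != tag -> 0 <= dist j)
  (delay_nint : forall j, j != tag ->
     total_delay c (delta j) (dist j) / Delta \isn't a Num.int) :
  let pI2 := Pr P2 (interference_event (X2 j2) K L Delta
                      (total_delay c delta2 dist2) t1) in
  let pI := Pr P (network_interference_event X tag K L Delta
                    (fun j => total_delay c (delta j) (dist j)) t1) in
  [/\ (forall i, chirp_shifts L i ->
         Pr P2 (start_event (X2 j2) K Delta (total_delay c delta2 dist2) t1 i)
         = start_event_prob P0 W K L),
      ((1 < K)%N \/ L = 1%N -> pI2 = two_radar_prob P0 W K L) &
      pI = 1 - (1 - pI2) ^+ M.-1].
Proof.
move=> pI2 pI.
have radar2 := net2.1 j2.
have pI2E : pI2 = interference_law P0 W K L by exact: Pr_interference.
split.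
- by move=> i _; rewrite start_eventE// (Pr_start_pair K_gt0 L_gt0 EW_fin radar2).
- move=> KL; have [L1|L1] := eqVneq L 1%N; last first.
    by rewrite pI2E /interference_law; case: KL => [->//|]; move/eqP: L1.
  (* For [L = 1] the union is a single window and the sum in the formula is empty, whatever [K]
     is. *)
  rewrite /pI2 interference_eventE// /two_radar_prob L1 big_geq// mulr0 subr0.
  rewrite bigcup_mkord big_ord1 /start_window mul0n addr0.
  by rewrite (Pr_start_pair K_gt0 L_gt0 EW_fin radar2) L1; ring.
- by rewrite pI2E; exact: Pr_network_interference.
Qed.
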